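(* $\mathcal{F}_{s}$ is an over radical in the category $\overline{\mathbf{L}}$ of Banach Lie algebras.
   Context: A Banach Lie algebra is a complex Lie algebra $\mathcal{L}$ which is a Banach space in a norm such that, for some $t_{\mathcal{L}}>0$, $\|[a,b]\|\leq t_{\mathcal{L}}\|a\|\|b\|$ for all $a,b\in\mathcal{L}$. Quotients by closed Lie ideals carry the quotient norm. $\overline{\mathbf{L}}$ is the category of all Banach Lie algebras with bounded Lie homomorphisms with dense image as morphisms. A preradical in $\overline{\mathbf{L}}$ is a map $R$ sending each Banach Lie algebra $\mathcal{L}$ to a closed Lie ideal $R(\mathcal{L})$ of $\mathcal{L}$ such that $f(R(\mathcal{L}))\subseteq R(\mathcal{M})$ for each morphism $f:\mathcal{L}\to\mathcal{M}$ in $\overline{\mathbf{L}}$. It is an over radical if it is upper stable, i.e. $R(\mathcal{L}/R(\mathcal{L}))=\{0\}$ for all $\mathcal{L}$, and balanced, i.e. $R(I)\subseteq R(\mathcal{L})$ for each closed Lie ideal $I$ of each $\mathcal{L}$. For a non-empty family $G$ of closed subspaces of a Banach space, $\mathfrak{p}(G)=\bigcap_{Y\in G}Y$ and $\mathfrak{s}(G)$ is the closed linear span of $\bigcup_{Y\in G}Y$. $G$ is complete if $G=\{\mathfrak{p}(G'):\varnothing\neq G'\subseteq G\}\cup\{\mathfrak{s}(G)\}$ and $G=\{\mathfrak{s}(G'):\varnothing\neq G'\subseteq G\}\cup\{\mathfrak{p}(G)\}$. $G$ is a lower finite-gap family if for each $Z\in G$ with $Z\neq\mathfrak{p}(G)$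 there is $Y\in G$ with $Y\subset Z$ and $0<\dim(Z/Y)<\infty$. A chain is a family $C$ totally ordered by inclusion; it is between $A$ and $B$ if $\mathfrak{p}(C)=A$ and $\mathfrak{s}(C)=B$. $\mathcal{L}$ is strongly $\mathcal{F}$-semisimple if there is a complete, lower finite-gap chain of closed Lie ideals of $\mathcal{L}$ between $\{0\}$ and $\mathcal{L}$. A closed Lie ideal $I$ of $\mathcal{L}$ is strongly $\mathcal{F}$-absorbing if $\mathcal{L}/I$ is strongly $\mathcal{F}$-semisimple. $\mathcal{F}_{s}(\mathcal{L})$ is the intersection of all strongly $\mathcal{F}$-absorbing ideals of $\mathcal{L}$. *)

(* Defs.v *)
From HB Require Import structures.
From mathcomp Require Import all_boot all_order all_algebra.
From mathcomp Require Import generic_quotient ring_quotient.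
From mathcomp Require Import complex.
From mathcomp Require Import interval_inference all_classical all_reals.
From mathcomp Require Import topology normedtype sequences ring.

Set Implicit Arguments.
Unset Strict Implicit.
Unset Printing Implicit Defensive.

Import Order.TTheory GRing.Theory Num.Theory.
Import numFieldTopology.Exports numFieldNormedType.Exports.

Local Open Scope classical_set_scope.
Local Open Scope ring_scope.
Local Open Scope complex_scope.

(* Norms of a normedModType over R[i] take values in R[i]; since u <= v in R[i]
   means that v - u is a nonnegative real, they are in fact real, and so is any
   t : R[i] with 0 < t. *)
HB.mixin Record isBanachLie (R : realType) L & CompleteNormedModule R[i] L := {
  lie : L -> L -> L;
  lie_linearl : forall (a : R[i]) x y z,
    lie (a *: x + y) z = a *: lie x z + lie y z;
  lie_linearr : forall (a : R[i]) x y z,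
    lie z (a *: x + y) = a *: lie z x + lie z y;
  liexx : forall x, lie x x = 0;
  lie_jacobi : forall x y z,
    lie x (lie y z) + lie y (lie z x) + lie z (lie x y) = 0;
  lie_bounded : exists2 t : R[i], 0 < t &
    forall x y, `|lie x y| <= t * `|x| * `|y|
}.

#[short(type="banachLieType")]
HB.structure Definition BanachLie (R : realType) :=
  {L of CompleteNormedModule R[i] L & isBanachLie R L}.

Section bracket_theory.
Variables (R : realType) (L : banachLieType R).
Implicit Types x y z : L.

Lemma lieDl x y z : lie (x + y) z = lie x z + lie y z.
Proof. by rewrite -[x in LHS]scale1r lie_linearl scale1r. Qed.

Lemma lieDr x y z : lie z (x + y) = lie z x + lie z y.
Proof. by rewrite -[x in LHS]scale1r lie_linearr scale1r. Qed.

Lemma lieBl x y z : lie (x - y) z = lie x z - lie y z.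
Proof. by rewrite addrC -scaleN1r lie_linearl scaleN1r addrC. Qed.

Lemma lieBr x y z : lie z (x - y) = lie z x - lie z y.
Proof. by rewrite addrC -scaleN1r lie_linearr scaleN1r addrC. Qed.

Lemma lie_antisym x y : lie x y = - lie y x.
Proof.
have := liexx (x + y); rewrite lieDl !lieDr !liexx add0r addr0.
by move/eqP; rewrite addr_eq0 => /eqP.
Qed.

End bracket_theory.

Definition is_subspace (R : realType) (V : lmodType R[i]) (Y : set V) : Prop :=
  Y 0 /\ forall (a : R[i]) x y, Y x -> Y y -> Y (a *: x + y).

Section closed_lie_ideals.
Variables (R : realType) (L : banachLieType R).

Definition is_closed_lie_ideal (I : set L) : Prop :=
  [/\ is_subspace I, forall x y, I y -> I (lie x y) & closed I].

Record closedLieIdeal := ClosedLieIdeal {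
  ideal_set :> set L;
  ideal_setP : is_closed_lie_ideal ideal_set
}.

End closed_lie_ideals.

Section ideal_predicate.
Variables (R : realType) (L : banachLieType R) (I : closedLieIdeal L).

Definition ideal_pred : {pred L} := fun x => x \in (I : set L).

Lemma ideal_predP x : reflect (ideal_set I x) (x \in ideal_pred).
Proof. by apply: (iffP idP); rewrite unfold_in /ideal_pred inE. Qed.

Lemma ideal_pred_submod : submod_closed ideal_pred.
Proof.
have [[I0 IZD] _ _] := ideal_setP I.
split; first exact/ideal_predP.
by move=> a x y /ideal_predP Ix /ideal_predP Iy; apply/ideal_predP/IZD.
Qed.

HB.instance Definition _ :=
  GRing.isSubmodClosed.Build R[i] L ideal_pred ideal_pred_submod.

End ideal_predicate.

Section ideal_as_banach_lie_algebra.
Variables (R : realType) (L : banachLieType R) (I : closedLieIdeal L).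

Definition idealAlg : Type := {x : L | x \in ideal_pred I}.

HB.instance Definition _ := [isSub of idealAlg for @sval L _].
HB.instance Definition _ := [Choice of idealAlg by <:].
HB.instance Definition _ := [SubChoice_isSubLmodule of idealAlg by <:].

Definition ideal_norm (x : idealAlg) : R[i] := `|val x|.

Fact ideal_normD x y : ideal_norm (x + y) <= ideal_norm x + ideal_norm y.
Proof. exact: ler_normD. Qed.

Fact ideal_normZ (a : R[i]) x : ideal_norm (a *: x) = `|a| * ideal_norm x.
Proof. exact: normrZ. Qed.

Fact ideal_norm0_eq0 x : ideal_norm x = 0 -> x = 0.
Proof. by move=> /normr0_eq0 x0; exact/val_inj. Qed.

HB.instance Definition _ :=
  Lmodule_isNormed.Build R[i] idealAlg ideal_normD ideal_normZ ideal_norm0_eq0.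

Fact ideal_cauchy_cvg (F : set_system idealAlg) : ProperFilter F -> cauchy F -> cvg F.
Proof.
move=> FF Fc.
have /cauchy_cvg/cvg_ex[l Fl] : cauchy (val @ F : set_system L).
  apply: (@cauchy_exP R[i]) => e e0.
  have /(@cauchyP R[i])/(_ e e0)[x Fx] := Fc; exists (val x).
  suff : F (val @^-1` ball (val x : L) e) by [].
  by apply: filterS Fx => y; rewrite -!ball_normE.
have Il : ideal_set I l.
  apply: (@closed_cvg _ _ F _ val (ideal_set I) _ _ l Fl).
    by have [] := ideal_setP I.
  by near=> x; exact/ideal_predP/(valP x).
have Il' : l \in ideal_pred I by exact/ideal_predP.
apply/cvg_ex; exists (exist _ l Il' : idealAlg).
apply/(@cvgrPdist_lt _ _ _ F _ id) => e e0.
by move/cvgrPdist_lt : Fl => /(_ e e0).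
Unshelve. all: by end_near. Qed.

HB.instance Definition _ := Uniform_isComplete.Build idealAlg ideal_cauchy_cvg.

Fact ideal_lie_subproof (x y : idealAlg) : lie (val x) (val y) \in ideal_pred I.
Proof.
by have [_ Il _] := ideal_setP I; apply/ideal_predP/Il/ideal_predP/(valP y).
Qed.

Definition ideal_lie (x y : idealAlg) : idealAlg :=
  exist (fun z => is_true (z \in ideal_pred I)) (lie (val x) (val y))
    (ideal_lie_subproof x y).

Fact ideal_lie_linearl (a : R[i]) x y z :
  ideal_lie (a *: x + y) z = a *: ideal_lie x z + ideal_lie y z.
Proof. by apply: val_inj; exact: lie_linearl. Qed.

Fact ideal_lie_linearr (a : R[i]) x y z :
  ideal_lie z (a *: x + y) = a *: ideal_lie z x + ideal_lie z y.
Proof. by apply: val_inj; exact: lie_linearr. Qed.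

Fact ideal_liexx x : ideal_lie x x = 0.
Proof. by apply: val_inj; exact: liexx. Qed.

Fact ideal_lie_jacobi x y z :
  ideal_lie x (ideal_lie y z) + ideal_lie y (ideal_lie z x) +
    ideal_lie z (ideal_lie x y) = 0.
Proof. by apply: val_inj; exact: lie_jacobi. Qed.

Fact ideal_lie_bounded : exists2 t : R[i], 0 < t &
  forall x y, `|ideal_lie x y| <= t * `|x| * `|y|.
Proof.
by have [t t0 H] := @lie_bounded R L; exists t => // x y; exact: H.
Qed.

HB.instance Definition _ := isBanachLie.Build R idealAlg
  ideal_lie_linearl ideal_lie_linearr ideal_liexx ideal_lie_jacobi ideal_lie_bounded.

Lemma val_idealAlg_lie (x y : idealAlg) :
  val (lie x y) = lie (val x) (val y) :> L.
Proof. by []. Qed.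

Lemma idealAlg_normE (x : idealAlg) : `|x| = `|val x : L|.
Proof. by []. Qed.

End ideal_as_banach_lie_algebra.

Section quotient_banach_lie_algebra.
Variables (R : realType) (L : banachLieType R) (I : closedLieIdeal L).
Local Open Scope quotient_scope.

Definition quotAlg : Type := Quotient.quot (ideal_pred I).

HB.instance Definition _ := GRing.Zmodule.on quotAlg.

Definition quot_pi (x : L) : quotAlg := \pi_(Quotient.quot (ideal_pred I)) x.

Definition quot_repr (q : quotAlg) : L := repr (q : Quotient.quot (ideal_pred I)).

Lemma quot_piK q : quot_pi (quot_repr q) = q.
Proof. exact: (@reprK _ (Quotient.quot (ideal_pred I))). Qed.

Lemma quot_piD x y : quot_pi (x + y) = quot_pi x + quot_pi y.
Proof. exact: raddfD. Qed.

Lemma quot_piN x : quot_pi (- x) = - quot_pi x.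
Proof. exact: raddfN. Qed.

Lemma quot_piB x y : quot_pi (x - y) = quot_pi x - quot_pi y.
Proof. by rewrite quot_piD quot_piN. Qed.

Lemma quot_pi_eq x y : quot_pi x = quot_pi y <-> ideal_set I (x - y).
Proof.
split=> [xy|/ideal_predP xy].
  by apply/ideal_predP; rewrite Quotient.idealrBE; apply/eqP.
by apply/eqP; rewrite -Quotient.idealrBE.
Qed.

Lemma quot_pi_eq0 x : quot_pi x = 0 <-> ideal_set I x.
Proof.
have <- : quot_pi 0 = 0 by exact: raddf0.
by rewrite quot_pi_eq subr0.
Qed.

Lemma quot_repr_pi x : ideal_set I (quot_repr (quot_pi x) - x).
Proof. by apply/quot_pi_eq; rewrite quot_piK. Qed.

Fact idealZ (a : R[i]) x : ideal_set I x -> ideal_set I (a *: x).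
Proof.
have [[I0 IZD] _ _] := ideal_setP I.
by move=> Ix; rewrite -[_ *: _]addr0; exact: IZD.
Qed.

Fact idealD x y : ideal_set I x -> ideal_set I y -> ideal_set I (x + y).
Proof.
have [[I0 IZD] _ _] := ideal_setP I.
by move=> Ix Iy; rewrite -[x]scale1r; exact: IZD.
Qed.

Definition quot_scale (a : R[i]) (q : quotAlg) : quotAlg := quot_pi (a *: quot_repr q).

Fact quot_scale_pi a x : quot_scale a (quot_pi x) = quot_pi (a *: x).
Proof. by apply/quot_pi_eq; rewrite -scalerBr; apply/idealZ/quot_repr_pi. Qed.

Fact quot_scaleA a b q : quot_scale a (quot_scale b q) = quot_scale (a * b) q.
Proof. by rewrite -(quot_piK q) !quot_scale_pi scalerA. Qed.

Fact quot_scale1 : left_id 1 quot_scale.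
Proof. by move=> q; rewrite -(quot_piK q) !quot_scale_pi scale1r. Qed.

Fact quot_scaleDr : right_distributive quot_scale +%R.
Proof.
move=> a q r; rewrite -(quot_piK q) -(quot_piK r).
by rewrite -quot_piD !quot_scale_pi scalerDr quot_piD.
Qed.

Fact quot_scaleDl q : {morph quot_scale^~ q : a b / a + b}.
Proof.
by move=> a b /=; rewrite -(quot_piK q) !quot_scale_pi scalerDl quot_piD.
Qed.

HB.instance Definition _ := GRing.Zmodule_isLmodule.Build R[i] quotAlg
  quot_scaleA quot_scale1 quot_scaleDr quot_scaleDl.

Lemma quot_piZ a x : quot_pi (a *: x) = a *: quot_pi x.
Proof. exact: esym (quot_scale_pi a x). Qed.

(* `|x| lies in R[i] but is a nonnegative real, so the infimum is taken in R. *)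
Definition quot_fiber_norms (q : quotAlg) : set R :=
  [set complex.Re `|x| | x in [set x : L | quot_pi x = q]].

Definition quot_norm (q : quotAlg) : R[i] := (inf (quot_fiber_norms q))%:C.

Fact Re_normK (x : L) : (complex.Re `|x|)%:C = `|x|.
Proof. by apply: RRe_real; exact: normr_real. Qed.

Fact quot_fiber_lb q : lbound (quot_fiber_norms q) 0.
Proof. by move=> _ [x _ <-]; rewrite -lecR Re_normK; exact: normr_ge0. Qed.

Fact quot_fiber_nonempty q : quot_fiber_norms q !=set0.
Proof.
by exists (complex.Re `|quot_repr q|), (quot_repr q) => //=; exact: quot_piK.
Qed.

Fact quot_norm_pi_le x : quot_norm (quot_pi x) <= `|x|.
Proof.
rewrite -Re_normK lecR; apply: ge_inf; last by exists x.
by exists 0; exact: quot_fiber_lb.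
Qed.

Fact quot_norm_ge0 q : 0 <= quot_norm q.
Proof. by rewrite ler0c; apply: lb_le_inf;
  [exact: quot_fiber_nonempty|exact: quot_fiber_lb]. Qed.

Fact quot_norm_lt q (e : R[i]) : quot_norm q < e -> exists2 x, quot_pi x = q & `|x| < e.
Proof.
move=> qe; have e0 : 0 <= e by exact: le_trans (quot_norm_ge0 q) (ltW qe).
have eE : (complex.Re e)%:C = e by apply: RRe_real; exact: ger0_real.
move: qe; rewrite -eE ltcR => /inf_lt -/(_ (quot_fiber_nonempty q)).
by case=> _ [x qx <-]; rewrite -ltcR Re_normK; exists x.
Qed.

Fact complex_le_addgt0P (u v : R[i]) : 0 <= v ->
  (forall e : R[i], 0 < e -> u <= v + e) -> u <= v.
Proof.
move=> v0 H; have vr : v \is Num.real by exact: ger0_real.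
have ur : u \is Num.real by rewrite (ler_real (H 1 ltr01)) rpredD// rpred1.
rewrite -(RRe_real ur) -(RRe_real vr) lecR; apply/ler_addgt0Pr => e e0.
rewrite -lecR rmorphD /= !RRe_real//; apply: H.
by rewrite ltcR.
Qed.

Fact quot_norm_mulP (u c : R[i]) q : 0 <= c ->
  (forall x, quot_pi x = q -> u <= c * `|x|) -> u <= c * quot_norm q.
Proof.
move=> c0 H; apply: complex_le_addgt0P => [|e e0]; first exact: mulr_ge0 (quot_norm_ge0 q).
have c10 : 0 < c + 1 by rewrite ltr_wpDl.
have [x xq xe] : exists2 x, quot_pi x = q & `|x| < quot_norm q + e / (c + 1).
  by apply: quot_norm_lt; rewrite ltrDl divr_gt0.
rewrite (le_trans (H _ xq))// (le_trans (ler_wpM2l c0 (ltW xe)))//.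
rewrite mulrDr lerD2l mulrCA ler_piMr ?(ltW e0)// ler_pdivrMr// mul1r.
by rewrite lerDl.
Qed.

Fact quot_normD q r : quot_norm (q + r) <= quot_norm q + quot_norm r.
Proof.
apply: complex_le_addgt0P => [|e e0]; first by rewrite addr_ge0 ?quot_norm_ge0.
have e20 : 0 < e / 2 by rewrite divr_gt0.
have [x <- xq] : exists2 x, quot_pi x = q & `|x| < quot_norm q + e / 2.
  by apply: quot_norm_lt; rewrite ltrDl.
have [y <- yr] : exists2 x, quot_pi x = r & `|x| < quot_norm r + e / 2.
  by apply: quot_norm_lt; rewrite ltrDl.
rewrite -quot_piD (le_trans (quot_norm_pi_le _))// (le_trans (ler_normD _ _))//.
rewrite [e]splitr addrACA; exact: lerD (ltW xq) (ltW yr).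
Qed.

Fact quot_normZ_le (a : R[i]) q : quot_norm (a *: q) <= `|a| * quot_norm q.
Proof.
apply: quot_norm_mulP => // x <-.
by rewrite -quot_piZ (le_trans (quot_norm_pi_le _))// normrZ.
Qed.

Fact quot_normZ (a : R[i]) q : quot_norm (a *: q) = `|a| * quot_norm q.
Proof.
apply/eqP; rewrite eq_le quot_normZ_le /=.
have [->|a0] := eqVneq a 0; first by rewrite normr0 mul0r quot_norm_ge0.
rewrite mulrC -ler_pdivlMr ?normr_gt0// mulrC -normfV.
by rewrite -[in leLHS](scale1r q) -(mulVf a0) -scalerA quot_normZ_le.
Qed.

Fact quot_norm0_eq0 q : quot_norm q = 0 -> q = 0.
Proof.
move=> q0; rewrite -(quot_piK q); apply/quot_pi_eq0.
have [_ _] := ideal_setP I; apply=> B /nbhs_ballP[e /= e0 eB].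
have [x xq xe] : exists2 x, quot_pi x = q & `|x| < e.
  by apply: quot_norm_lt; rewrite q0.
exists (quot_repr q - x); split; first by apply/quot_pi_eq; rewrite quot_piK.
by apply: eB; rewrite -ball_normE /= opprB addrC subrK.
Qed.

HB.instance Definition _ :=
  Lmodule_isNormed.Build R[i] quotAlg quot_normD quot_normZ quot_norm0_eq0.

Fact quot_cauchy_cvg (F : set_system quotAlg) : ProperFilter F -> cauchy F -> cvg F.
Proof.
move=> FF /(@cauchyP R[i]) Fc.
pose eps n : R[i] := 2^-1 ^+ n.
have eps0 n : 0 < eps n by rewrite exprn_gt0// invr_gt0.
have epsS n : eps n = eps n.+1 + eps n.+1.
  by rewrite [LHS]splitr /eps exprSr.
have eps_lt e : 0 < e -> \forall n \near \oo, eps n < e.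
  move=> e0; have er : e \is Num.real by exact: gtr0_real.
  have Re0 : 0 < complex.Re e by rewrite -ltcR RRe_real.
  near=> n; rewrite -(RRe_real er).
  have -> : eps n = (1 / 2 ^+ n : R)%:C.
    rewrite /eps div1r -exprVn rmorphXn /=; congr (_ ^+ n).
    by rewrite fmorphV rmorph_nat.
  rewrite ltcR; near: n.
  exact: (near_infty_natSinv_expn_lt (PosNum Re0)).
have /choice[q Fq] : forall n, exists q, F (ball q (eps n)).
  by move=> n; exact: Fc.
have qd n : `|q n.+1 - q n| < eps n + eps n.
  have [z []] := filter_ex (filterI (Fq n) (Fq n.+1)).
  rewrite -!ball_normE /= distrC => zn zn1.
  rewrite -(subrKA z) (le_lt_trans (ler_normD _ _))// addrC ltrD//.
    by rewrite (lt_le_trans zn1)// [leRHS]epsS lerDl ltW.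
have /choice[d dP] : forall n, exists x,
    quot_pi x = q n.+1 - q n /\ `|x| < eps n + eps n.
  by move=> n; have [x ? ?] := quot_norm_lt (qd n); exists x.
pose x n := quot_repr (q 0%N) + \sum_(i < n) d i.
have xS n : x n.+1 = x n + d n by rewrite /x big_ord_recr addrA.
have xq n : quot_pi (x n) = q n.
  elim: n => [|n IH]; first by rewrite /x big_ord0 addr0 quot_piK.
  by rewrite xS quot_piD IH (dP n).1 addrC subrK.
have xd n k : `|x (n + k)%N - x n| <= (eps n - eps (n + k)%N) *+ 4.
  elim: k => [|k IH]; first by rewrite addn0 !subrr normr0 mul0rn.
  rewrite addnS xS addrAC (le_trans (ler_normD _ _))//.
  rewrite (le_trans (lerD IH (ltW (dP _).2)))//.
  rewrite (epsS (n + k)%N).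
  set u := eps n; set v := eps _.
  rewrite le_eqVlt; apply/orP; left; apply/eqP.
  by rewrite !mulrnBl !mulrS !mulr0n; ring.
have /cauchy_cvg/cvg_ex[l xl] : cauchy (x @ \oo : set_system L).
  apply: (@cauchy_exP R[i]) => e e0.
  have e40 : 0 < e / 4 by rewrite divr_gt0.
  have [n ne] := filter_ex (eps_lt _ e40).
  exists (x n); exists n => // m /= /subnKC <-.
  rewrite -ball_normE /= distrC (le_lt_trans (xd _ _))//.
  rewrite -[e](divfK (_ : 4 != 0)) ?pnatr_eq0// mulr_natr ltrMn2r /=.
  by rewrite (lt_trans _ ne)// ltrBlDr ltrDl.
apply/cvg_ex; exists (quot_pi l).
apply/(@cvgrPdist_lt _ _ _ F _ id) => e e0.
have e20 : 0 < e / 2 by rewrite divr_gt0.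
have /filter_ex[n [xn en]] :
    \forall n \near \oo, `|l - x n| < e / 2 /\ eps n < e / 2.
  by near=> n; split; near: n; [move/cvgrPdist_lt : xl; exact|exact: eps_lt].
apply: filterS (Fq n) => z; rewrite -ball_normE /= => qz.
rewrite -(subrKA (q n)) (le_lt_trans (ler_normD _ _))// [ltRHS]splitr ltrD//.
  by rewrite -xq -quot_piB (le_lt_trans (quot_norm_pi_le _)).
exact: lt_trans en.
Unshelve. all: by end_near. Qed.

HB.instance Definition _ := Uniform_isComplete.Build quotAlg quot_cauchy_cvg.

Definition quot_lie (q r : quotAlg) : quotAlg := quot_pi (lie (quot_repr q) (quot_repr r)).

Fact quot_lie_pi x y : quot_lie (quot_pi x) (quot_pi y) = quot_pi (lie x y).
Proof.
have [_ Il _] := ideal_setP I; apply/quot_pi_eq.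
rewrite -(subrKA (lie (quot_repr (quot_pi x)) y)) -lieBr -lieBl; apply: idealD.
  by apply: Il; exact: quot_repr_pi.
rewrite lie_antisym -scaleN1r; apply: idealZ; apply: Il.
exact: quot_repr_pi.
Qed.

Fact quot_lie_linearl (a : R[i]) x y z :
  quot_lie (a *: x + y) z = a *: quot_lie x z + quot_lie y z.
Proof.
rewrite -(quot_piK x) -(quot_piK y) -(quot_piK z).
by rewrite -quot_piZ -quot_piD !quot_lie_pi -quot_piZ -quot_piD lie_linearl.
Qed.

Fact quot_lie_linearr (a : R[i]) x y z :
  quot_lie z (a *: x + y) = a *: quot_lie z x + quot_lie z y.
Proof.
rewrite -(quot_piK x) -(quot_piK y) -(quot_piK z).
by rewrite -quot_piZ -quot_piD !quot_lie_pi -quot_piZ -quot_piD lie_linearr.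
Qed.

Fact quot_liexx x : quot_lie x x = 0.
Proof. by rewrite -(quot_piK x) quot_lie_pi liexx; exact: raddf0. Qed.

Fact quot_lie_jacobi x y z :
  quot_lie x (quot_lie y z) + quot_lie y (quot_lie z x) +
    quot_lie z (quot_lie x y) = 0.
Proof.
rewrite -(quot_piK x) -(quot_piK y) -(quot_piK z) !quot_lie_pi -!quot_piD.
by rewrite lie_jacobi; exact: raddf0.
Qed.

Fact quot_lie_bounded : exists2 t : R[i], 0 < t &
  forall x y, `|quot_lie x y| <= t * `|x| * `|y|.
Proof.
have [t t0 H] := @lie_bounded R L; exists t => // q r.
apply: quot_norm_mulP => [|y <-]; first by rewrite mulr_ge0// ltW.
rewrite mulrAC; apply: quot_norm_mulP => [|x <-]; first by rewrite mulr_ge0// ltW.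
by rewrite quot_lie_pi (le_trans (quot_norm_pi_le _))// mulrAC.
Qed.

HB.instance Definition _ := isBanachLie.Build R quotAlg
  quot_lie_linearl quot_lie_linearr quot_liexx quot_lie_jacobi quot_lie_bounded.

Lemma quot_normE (q : quotAlg) :
  `|q| = (inf [set complex.Re `|x| | x in [set x : L | quot_pi x = q]])%:C.
Proof. by []. Qed.

Lemma quot_pi_lie x y : quot_pi (lie x y) = lie (quot_pi x) (quot_pi y).
Proof. exact: esym (quot_lie_pi x y). Qed.

End quotient_banach_lie_algebra.

Section families_of_subspaces.
Variables (R : realType) (V : normedModType R[i]).
Implicit Types (G C : set (set V)) (Y Z A : set V).

Definition lspan A : set V :=
  [set x | exists n (c : 'I_n -> R[i]) (v : 'I_n -> V),
    (forall i, A (v i)) /\ x = \sum_(i < n) c i *: v i].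

Definition fam_meet G : set V := \bigcap_(Y in G) Y.

Definition fam_join G : set V := closure (lspan (\bigcup_(Y in G) Y)).

Definition nonempty_subfamilies G : set (set (set V)) :=
  [set G' | G' !=set0 /\ G' `<=` G].

Definition complete_family G : Prop :=
  G = [set fam_meet G' | G' in nonempty_subfamilies G] `|` [set fam_join G] /\
  G = [set fam_join G' | G' in nonempty_subfamilies G] `|` [set fam_meet G].

(* dim (Z / Y) = n, for subspaces Y of Z: the classes modulo Y of some n
   vectors of Z form a basis of Z / Y. *)
Definition quotient_dim Z Y n : Prop :=
  exists v : 'I_n -> V, (forall i, Z (v i)) /\
    forall z, Z z -> exists! c : 'rV[R[i]]_n, Y (z - \sum_(i < n) c 0 i *: v i).

Definition lower_finite_gap G : Prop :=
  forall Z, G Z -> Z <> fam_meet G ->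
    exists Y, [/\ G Y, Y `<` Z & exists2 n, (0 < n)%N & quotient_dim Z Y n].

Definition is_chain C : Prop := C !=set0 /\ total_on C subset.

Definition between C A B : Prop := fam_meet C = A /\ fam_join C = B.

End families_of_subspaces.

Section radicals.
Variable R : realType.

Definition is_morphism (L M : banachLieType R) (f : L -> M) : Prop :=
  [/\ forall (a : R[i]) x y, f (a *: x + y) = a *: f x + f y,
      forall x y, f (lie x y) = lie (f x) (f y),
      exists k : R[i], forall x, `|f x| <= k * `|x|
    & dense (range f)].

Definition ideal_map : Type := forall L : banachLieType R, closedLieIdeal L.

Definition preradical (T : ideal_map) : Prop :=
  forall (L M : banachLieType R) (f : L -> M), is_morphism f ->
    f @` T L `<=` T M.

Definition upper_stable (T : ideal_map) : Prop :=
  forall L : banachLieType R, T (quotAlg (T L)) = [set 0] :> set _.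

Definition balanced (T : ideal_map) : Prop :=
  forall (L : banachLieType R) (I : closedLieIdeal L),
    (val : idealAlg I -> L) @` T (idealAlg I) `<=` T L.

Definition over_radical (T : ideal_map) : Prop :=
  [/\ preradical T, upper_stable T & balanced T].

Definition strongly_F_semisimple (L : banachLieType R) : Prop :=
  exists C : set (set L),
    [/\ is_chain C, C `<=` @is_closed_lie_ideal R L, complete_family C,
        lower_finite_gap C & between C [set 0] setT].

Definition strongly_F_absorbing (L : banachLieType R) (I : closedLieIdeal L) :
  Prop := strongly_F_semisimple (quotAlg I).

(* Absorbing ideals always exist: L is one, as the chain [set [set 0]] shows. *)
Definition F_s_set (L : banachLieType R) : set L :=
  \bigcap_(I in @strongly_F_absorbing L) (I : set L).

Fact F_s_subproof (L : banachLieType R) : is_closed_lie_ideal (@F_s_set L).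
Proof.
split; [split | |].
- by move=> I _; have [[]] := ideal_setP I.
- move=> a x y Fx Fy I HI; have [[_ IZD] _ _] := ideal_setP I.
  by apply: IZD; [exact: Fx | exact: Fy].
- move=> x y Fy I HI; have [_ Il _] := ideal_setP I.
  by apply: Il; exact: Fy.
- by apply: closed_bigI => I _; have [] := ideal_setP I.
Qed.

Definition F_s : ideal_map := fun L => ClosedLieIdeal (@F_s_subproof L).

End radicals.

(* Main.v *)
(* A Banach Lie algebra L is strongly F-semisimple iff every set Z not contained
   in {0} lies in a closed ideal W of which some closed ideal Y not containing Z
   is a finite-codimensional subspace. Given a chain, W is the meet of its
   members containing Z and Y the member given by the finite gap below W.
   Conversely, intersecting with Z, every nonzero closed ideal Z contains a
   strictly smaller closed ideal phi(Z) of finite codimension; the smallest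
   family closed under phi and arbitrary meets is a chain by Zermelo's argument
   and contains the joins of its nonempty subfamilies because they are attained.
   The chain-free criterion pulls back along separating families of bounded Lie
   homomorphisms. Hence preimages of absorbing ideals are absorbing, which gives
   functoriality for all bounded homomorphisms, inclusions of ideals included,
   and F_s(L), an intersection of absorbing ideals, is itself absorbing, so that
   L / F_s(L) is strongly F-semisimple and its F_s vanishes. *)
From mathcomp Require Import all_boot all_order all_algebra complex.
From mathcomp Require Import all_classical.
From mathcomp Require Import topology normedtype.
Require Import Defs.
From mathcomp Require Import all_reals.

Set Implicit Arguments.
Unset Strict Implicit.
Unset Printing Implicit Defensive.

Import Order.TTheory GRing.Theory Num.Theory.
Import numFieldTopology.Exports numFieldNormedType.Exports.

Local Open Scope classical_set_scope.
Local Open Scope ring_scope.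

(** * Towers of a decreasing map, after Zermelo *)

Section tower.
Variables (T : Type) (phi : set T -> set T).
Hypothesis phi_sub : forall Z, phi Z `<=` Z.

(** The empty family is allowed in [tower_meet], so the whole space is a member and no base case is
    needed. *)
Inductive tower : set (set T) :=
| tower_next Z of tower Z : tower (phi Z)
| tower_meet (G : set (set T)) of G `<=` tower : tower (\bigcap_(Y in G) Y).

(** Zermelo's device for comparability: [phi] never carries a member strictly above [x] out of the
    sets containing [x]. *)
Let extreme x := forall y, tower y -> x `<` y -> x `<=` phi y.

(** Induction on [y]: extremality of [x] settles the step by [phi], and a meet lies below [phi x] as
    soon as one of its terms does. *)
Let extreme_dichotomy x y : extreme x -> tower y -> x `<=` y \/ y `<=` phi x.
Proof.
move=> ex; elim=> [Z tZ [xZ|Zx]|G tG IH].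
- have [Zx|nZx] := pselect (Z `<=` x).
    by right; rewrite (_ : Z = x)//; exact/seteqP.
  by left; apply: ex.
- by right; apply: subset_trans Zx; exact: phi_sub.
- have [[Y GY Yx]|nG] := pselect (exists2 Y, G Y & Y `<=` phi x).
    by right => t /(_ _ GY) /Yx.
  left=> t xt Y GY; have [|Yx] := IH Y GY; first exact.
  by case: nG; exists Y.
Qed.

Let tower_extreme x : tower x -> extreme x.
Proof.
elim=> {x} [x tx ex|G tG eG] y ty.
- move=> [xy nyx]; have [xy'|//] := extreme_dichotomy ex ty.
  have [yx|nyx'] := pselect (y `<=` x); last first.
    by apply: (subset_trans (@phi_sub x)); apply: ex.
  by rewrite (_ : y = x)//; exact/seteqP.
- move=> [Gy nyG].
  have [[Y GY Yy]|nG] := pselect (exists2 Y, G Y & Y `<=` y); last first.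
    case: nyG => t yt Y GY.
    have [Yy|yY] := extreme_dichotomy (eG _ GY) ty; first by case: nG; exists Y.
    exact: (phi_sub (yY _ yt)).
  have [yY|nyY] := pselect (y `<=` Y); last first.
    apply: (@subset_trans _ Y); last exact: eG.
    by move=> t; apply.
  (* Now [y] is itself a term of the meet, hence extreme, and can be compared with the meet in
     turn. *)
  have yE : y = Y by exact/seteqP.
  have ey : extreme y by rewrite yE; exact: eG.
  by have [/nyG|] := extreme_dichotomy ey (tower_meet tG).
Qed.

Lemma tower_dichotomy x y : tower x -> tower y -> x `<=` y \/ y `<=` phi x.
Proof. by move=> /tower_extreme; exact: extreme_dichotomy. Qed.

Lemma tower_total : total_on tower subset.
Proof.
move=> x y tx ty; have [|yx] := tower_dichotomy tx ty; first by left.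
by right; apply: (subset_trans yx); exact: phi_sub.
Qed.

(* The meet of the upper bounds is itself a member: otherwise every member
   of G lies below its image by [phi], a smaller upper bound. *)
Lemma tower_max (G : set (set T)) : G !=set0 -> G `<=` tower ->
  exists W, [/\ tower W, forall Y, G Y -> Y `<=` W & G W \/ phi W = W].
Proof.
move=> [Y0 GY0] tG.
pose U := [set X | tower X /\ forall Y, G Y -> Y `<=` X].
have tW : tower (\bigcap_(X in U) X) by apply: tower_meet => X [].
set W := \bigcap_(X in U) X in tW *.
have GW Y : G Y -> Y `<=` W by move=> GY t Yt X [_ GX]; exact: (GX Y).
exists W; split => //; have [|nGW] := pselect (G W); first by left.
right; apply/seteqP; split; first exact: phi_sub.
suff UphiW : U (phi W) by move=> t; exact.
split; first exact: tower_next.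
move=> Y GY; have [WY|//] := tower_dichotomy tW (tG _ GY).
by case: nGW; rewrite (_ : W = Y)//; apply/seteqP; split => //; exact: GW.
Qed.

End tower.

(** * Closed spans and finite codimension *)

Section subspaces.
Variables (R : realType) (V : normedModType R[i]).
Implicit Types (W Y Z A : set V).

Lemma subspace_sum W n (F : 'I_n -> V) :
  is_subspace W -> (forall i, W (F i)) -> W (\sum_i F i).
Proof.
move=> [W0 WZD] WF; elim/big_ind : _ => // x y Wx Wy.
by rewrite -[x]scale1r; exact: WZD.
Qed.

Lemma subspaceZ W (a : R[i]) x : is_subspace W -> W x -> W (a *: x).
Proof. by move=> [W0 WZD] Wx; rewrite -[_ *: _]addr0; exact: WZD. Qed.

Lemma closed_span_sub W A : is_subspace W -> closed W -> A `<=` W ->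
  closure (lspan A) `<=` W.
Proof.
move=> sW cW AW; rewrite (closure_id W).1//; apply: closure_subset.
move=> _ [n [c [v [Av ->]]]]; apply: subspace_sum => // i.
by apply: subspaceZ => //; exact: AW.
Qed.

Lemma sub_closed_span A : A `<=` closure (lspan A).
Proof.
move=> x Ax; apply: subset_closure; exists 1%N, (fun=> 1), (fun=> x).
by rewrite big_ord1 scale1r.
Qed.

Lemma fam_join_max (G : set (set V)) W : is_subspace W -> closed W -> G W ->
  (forall Y, G Y -> Y `<=` W) -> fam_join G = W.
Proof.
move=> sW cW GW GleW; apply/seteqP; split.
  by apply: closed_span_sub => // x [Y GY] /(GleW _ GY).
by move=> x Wx; apply: sub_closed_span; exists W.
Qed.

(* Unlike [quotient_dim], this form of dim (W / Y) <= n restricts to subspaces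
   and pulls back along linear maps without any choice of basis. *)
Definition cut_by W Y n (g : V -> 'rV[R[i]]_n) : Prop :=
  (forall (a : R[i]) x y, W x -> W y -> g (a *: x + y) = a *: g x + g y) /\
  (forall x, W x -> (Y x <-> g x = 0)).

(** Coordinates in the given basis of [W / Y] serve as [g]; their uniqueness makes [g] linear on
    [W]. *)
Lemma quotient_dim_cut W Y n : is_subspace W -> is_subspace Y ->
  quotient_dim W Y n -> exists g : V -> 'rV_n, cut_by W Y g.
Proof.
move=> [W0 WZD] [Y0 YZD] [v [Wv vP]].
have /choice[g gP] : forall z, exists c : 'rV[R[i]]_n,
    W z -> Y (z - \sum_(i < n) c 0 i *: v i) /\
      forall c' : 'rV_n, Y (z - \sum_(i < n) c' 0 i *: v i) -> c = c'.
  move=> z; have [/vP[c [? ?]]|?] := pselect (W z); first by exists c.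
  by exists 0.
exists g; split=> [a x y Wx Wy|x Wx].
  apply: (gP _ (WZD _ _ _ Wx Wy)).2.
  have -> : a *: x + y - \sum_(i < n) (a *: g x + g y) 0 i *: v i =
      a *: (x - \sum_(i < n) g x 0 i *: v i) + (y - \sum_(i < n) g y 0 i *: v i).
    rewrite scalerBr scaler_sumr addrACA -opprD -big_split/=; congr (_ - _).
    by apply: eq_bigr => i _; rewrite !mxE scalerDl scalerA.
  by apply: YZD; [exact: (gP _ Wx).1|exact: (gP _ Wy).1].
have sum0 : \sum_(i < n) (0 : 'rV[R[i]]_n) 0 i *: v i = 0.
  by rewrite big1// => i _; rewrite mxE scale0r.
split=> [Yx|gx0]; first by apply: (gP _ Wx).2; rewrite sum0 subr0.
by have := (gP _ Wx).1; rewrite gx0 sum0 subr0.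
Qed.

(** [g] embeds [W / Y] into row vectors, so a longest family in [W] with independent images gives a
    basis. *)
Lemma cut_quotient_dim W Y n (g : V -> 'rV[R[i]]_n) :
  is_subspace W -> cut_by W Y g -> exists k, quotient_dim W Y k.
Proof.
move=> sW [glin gker]; have [W0 WZD] := sW.
have g0 : g 0 = 0.
  have := glin (-1) 0 0 W0 W0.
  by rewrite scaler0 add0r scaleN1r addNr.
have gsum k (c : 'rV[R[i]]_k) v : (forall i, W (v i)) ->
    g (\sum_(i < k) c 0 i *: v i) = c *m (\matrix_i g (v i)).
  move=> Wv; rewrite mulmx_sum_row.
  elim: k c v Wv => [|k IH] c v Wv; first by rewrite !big_ord0.
  rewrite !big_ord_recl glin//; last first.
    by apply: subspace_sum => // i; exact: subspaceZ.
  rewrite rowK; congr (_ + _).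
  have := IH (\row_i c 0 (lift ord0 i)) (fun i => v (lift ord0 i)) (fun=> Wv _).
  under eq_bigr do rewrite mxE.
  move=> ->; by apply: eq_bigr => i _; rewrite mxE !rowK.
pose free k := exists v : 'I_k -> V,
  (forall i, W (v i)) /\ row_free (\matrix_i g (v i)).
have free0 : exists k, `[< free k >].
  exists 0%N; apply/asboolP; exists (fun=> 0); split=> [[]//|].
  by rewrite /row_free flatmx0 mxrank0.
have free_le k : `[< free k >] -> (k <= n)%N.
  by move=> /asboolP[v [_ /eqP <-]]; exact: rank_leq_col.
case: (ex_maxnP free0 free_le) => k /asboolP[v [Wv vfree]] kmax.
exists k, v; split => // z Wz.
have Wzc (c : 'rV_k) : W (z - \sum_(i < k) c 0 i *: v i).
  rewrite addrC -scaleN1r; apply: WZD => //; apply: subspace_sum => // i.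
  exact: subspaceZ.
have Yzc (c : 'rV_k) : Y (z - \sum_(i < k) c 0 i *: v i) <->
    g z = c *m (\matrix_i g (v i)).
  apply: (iff_trans (gker _ (Wzc c))).
  rewrite addrC -scaleN1r glin ?gsum//; last first.
    by apply: subspace_sum => // i; exact: subspaceZ.
  rewrite scaleN1r addrC; split=> [/eqP|->]; last by rewrite subrr.
  by rewrite subr_eq0 => /eqP.
have /submxP[c gzc] : (g z <= \matrix_i g (v i))%MS.
  (* Otherwise appending [z] would give a longer independent family. *)
  apply: contrapT => /negP nz.
  have : (k + 1 <= k)%N; last by rewrite addn1 ltnn.
  apply: kmax; apply/asboolP.
  pose v' (i : 'I_(k + 1)) := match fintype.split i with inl j => v j | inr _ => z end.
  exists v'; split.
    by move=> i; rewrite /v'; case: (fintype.split i).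
  have -> : \matrix_i g (v' i) = col_mx (\matrix_i g (v i)) (g z).
    apply/row_matrixP => i; rewrite rowK /v'.
    case: (fintype.split i) (splitK i) => j /= <-; first by rewrite rowKu rowK.
    by rewrite rowKd row_id.
  have : (\matrix_i g (v i) < \matrix_i g (v i) + g z)%MS.
    by rewrite ltmxE addsmxSl addsmx_sub submx_refl.
  move=> /rank_ltmx; rewrite (eqP vfree) => k_lt.
  by rewrite /row_free eqn_leq rank_leq_row -addsmxE addn1.
exists c; split; first exact/Yzc.
by move=> c' /Yzc; rewrite gzc; exact: row_free_inj.
Qed.

End subspaces.

(** * Bounded Lie homomorphisms and quotients *)

Section lie_homomorphisms.
Variable R : realType.

(* Density of the range is left out so that inclusions of ideals are covered. *)
Definition bounded_lie_hom (L M : banachLieType R) (f : L -> M) : Prop :=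
  [/\ forall (a : R[i]) x y, f (a *: x + y) = a *: f x + f y,
      forall x y, f (lie x y) = lie (f x) (f y)
    & exists k : R[i], forall x, `|f x| <= k * `|x|].

Lemma bounded_lie_hom0 (L M : banachLieType R) (f : L -> M) :
  bounded_lie_hom f -> f 0 = 0.
Proof.
by move=> [flin _ _]; have := flin (-1) 0 0; rewrite scaler0 add0r scaleN1r addNr.
Qed.

Lemma bounded_lie_homB (L M : banachLieType R) (f : L -> M) x y :
  bounded_lie_hom f -> f (x - y) = f x - f y.
Proof. by move=> [flin _ _]; rewrite addrC -scaleN1r flin scaleN1r addrC. Qed.

Lemma bounded_lie_hom_bound (L M : banachLieType R) (f : L -> M) :
  bounded_lie_hom f -> exists2 k : R[i], 0 < k & forall x, `|f x| <= k * `|x|.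
Proof.
(* The given [k] may be zero, or even non-real when [L] is trivial. *)
move=> [_ _ [k fk]]; exists (`|k| + 1) => [|x]; first by rewrite ltr_wpDl.
have kx0 : 0 <= k * `|x| by exact: le_trans (fk x).
rewrite (le_trans (fk x))// -(ger0_norm kx0) normrM normr_id.
by rewrite ler_wpM2r// lerDl.
Qed.

Lemma bounded_lie_hom_comp (L M N : banachLieType R) (f : L -> M) (g : M -> N) :
  bounded_lie_hom f -> bounded_lie_hom g -> bounded_lie_hom (g \o f).
Proof.
move=> fhom ghom; have [[flin flie _] [glin glie _]] := (fhom, ghom).
have [k k0 fk] := bounded_lie_hom_bound fhom.
have [l l0 gl] := bounded_lie_hom_bound ghom.
split=> [a x y|x y|] /=; first by rewrite flin glin.
  by rewrite flie glie.
exists (l * k) => x; rewrite (le_trans (gl _))// -mulrA.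
by rewrite ler_wpM2l// ltW.
Qed.

Lemma bounded_lie_hom_continuous (L M : banachLieType R) (f : L -> M) :
  bounded_lie_hom f -> continuous f.
Proof.
move=> fhom x; have [k k0 fk] := bounded_lie_hom_bound fhom.
apply/cvgrPdist_lt => e e0; near=> y.
rewrite -bounded_lie_homB// (le_lt_trans (fk _))// mulrC -ltr_pdivlMr//.
near: y; apply: cvgr_dist_lt; last exact: divr_gt0.
exact: cvg_id.
Unshelve. all: by end_near. Qed.

Lemma ideal_preimage (L M : banachLieType R) (f : L -> M) (I : set M) :
  bounded_lie_hom f -> is_closed_lie_ideal I -> is_closed_lie_ideal (f @^-1` I).
Proof.
move=> fhom [[I0 IZD] Il Ic]; have [flin flie _] := fhom.
split; [split| |].
- by rewrite /preimage/= bounded_lie_hom0.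
- by move=> a x y Ix Iy; rewrite /preimage/= flin; exact: IZD.
- by move=> x y Iy; rewrite /preimage/= flie; exact: Il.
- by apply: closed_comp => // x _; exact: bounded_lie_hom_continuous.
Qed.

Lemma quot_pi_hom (L : banachLieType R) (I : closedLieIdeal L) :
  bounded_lie_hom (@quot_pi R L I).
Proof.
split=> [a x y|x y|]; first by rewrite quot_piD quot_piZ.
  exact: quot_pi_lie.
by exists 1 => x; rewrite mul1r; exact: quot_norm_pi_le.
Qed.

(** Evaluating [f] on representatives is well defined, and the bound for [f] passes to the infimum
    over each fibre. *)
Lemma quot_lift (L N : banachLieType R) (I : closedLieIdeal L) (f : L -> N) :
  bounded_lie_hom f -> (forall x, ideal_set I x -> f x = 0) ->
  exists2 h : quotAlg I -> N, bounded_lie_hom h & forall x, h (quot_pi I x) = f x.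
Proof.
move=> fhom fI; have [flin flie _] := fhom.
have [k k0 fk] := bounded_lie_hom_bound fhom.
pose h (q : quotAlg I) := f (quot_repr q).
have hpi x : h (quot_pi I x) = f x.
  apply/eqP; rewrite -subr_eq0 /h -(bounded_lie_homB _ _ fhom); apply/eqP/fI.
  exact: quot_repr_pi.
exists h => //; split=> [a q r|q r|].
- by rewrite -(quot_piK q) -(quot_piK r) -quot_piZ -quot_piD !hpi.
- by rewrite -(quot_piK q) -(quot_piK r) -quot_pi_lie !hpi.
- exists k => q; apply: quot_norm_mulP => [|x <-]; first exact: ltW.
  by rewrite hpi.
Qed.

End lie_homomorphisms.

(** * The chain-free criterion and the radical *)

Section semisimplicity.
Variable R : realType.
Implicit Types L M N : banachLieType R.

(* Equivalent to strong F-semisimplicity, but free of chains, and inherited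
   along families of bounded Lie homomorphisms that separate points. *)
Definition finite_gap_below L : Prop :=
  forall (Z : set L) z, Z z -> z <> 0 ->
    exists Y W n (g : L -> 'rV[R[i]]_n),
      [/\ is_closed_lie_ideal Y, is_closed_lie_ideal W, cut_by W Y g, Z `<=` W
        & ~ Z `<=` Y].

Lemma semisimple_finite_gap_below L :
  strongly_F_semisimple L -> finite_gap_below L.
Proof.
move=> [C [_ Cideal [Cmeet _] Cgap [C0 CT]]] Z z Zz z0.
pose U := [set X | C X /\ Z `<=` X].
have CU : C (fam_meet U).
  rewrite Cmeet; left; exists U => //; split; last by move=> X [].
  (* [U] is nonempty: the whole algebra is the join of [C], which completeness puts in [C]. *)
  exists setT; split => //; rewrite Cmeet; right.
  exact: esym.
have [|Y [CY [YU nUY] [n _ UYn]]] := Cgap _ CU.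
  rewrite C0 => U0; apply: z0; have : fam_meet U z by move=> X [_]; apply.
  by rewrite U0.
have [[sY _ _] [sU _ _]] := (Cideal _ CY, Cideal _ CU).
have [g gP] := quotient_dim_cut sU sY UYn.
exists Y, (fam_meet U), n, g; split=> //; [exact: Cideal|exact: Cideal| |].
- by move=> t Zt X [_]; apply.
(* If [Y] contained [Z], it would belong to [U] and so contain the meet of [U]. *)
- by move=> ZY; apply: nUY => t; apply.
Qed.

Lemma finite_gap_below_ideal L (Z : set L) : finite_gap_below L ->
  is_closed_lie_ideal Z -> Z <> [set 0] ->
  exists Y, [/\ is_closed_lie_ideal Y, Y `<` Z
    & exists2 n, (0 < n)%N & quotient_dim Z Y n].
Proof.
move=> Lgap Zideal Z0; have [[Zz ZZD] Zl Zc] := Zideal.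
have [z Zz' z0] : exists2 z, Z z & z <> 0.
  apply: contrapT => nZ; apply: Z0; apply/seteqP; split=> [z Zz'|_ ->//].
  by apply: contrapT => z0; apply: nZ; exists z.
have [Y [W [n [g [[[Y0 YZD] Yl Yc] _ [glin gker] ZW nZY]]]]] := Lgap Z z Zz' z0.
exists (Z `&` Y); split.
- split; [split=> //| |exact: closedI].
    by move=> a x y [? ?] [? ?]; split; [exact: ZZD|exact: YZD].
  by move=> x y [? ?]; split; [exact: Zl|exact: Yl].
- by split=> [x []//|ZY]; apply: nZY => x /ZY[].
have /cut_quotient_dim[] : cut_by Z (Z `&` Y) g.
  split=> [a x y /ZW Wx /ZW Wy|x Zx]; first exact: glin.
  by rewrite -gker; [split=> [[]|]|exact: ZW].
- by split.
(* In dimension 0 the sum is empty, which would force [Z] into [Y]. *)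
move=> k kP; exists k => //; rewrite lt0n; apply/eqP => k0.
apply: nZY => x Zx; move: kP; rewrite k0 => -[v [_ /(_ _ Zx)[c [[_ Yx] _]]]].
by move: Yx; rewrite big_ord0 subr0.
Qed.

Lemma finite_gap_below_semisimple L :
  finite_gap_below L -> strongly_F_semisimple L.
Proof.
move=> Lgap.
have /choice[phi phiP] : forall Z : set L, exists Y, Y `<=` Z /\
    (is_closed_lie_ideal Z -> is_closed_lie_ideal Y /\
      (Z <> [set 0] ->
        Y `<` Z /\ exists2 n, (0 < n)%N & quotient_dim Z Y n)).
  move=> Z; have [[Zideal Z0]|nZ] :=
      pselect (is_closed_lie_ideal Z /\ Z <> [set 0]); last first.
    by exists Z; split => // Zideal; split => // Z0; case: nZ.
  have [Y [Yideal YZ Yn]] := finite_gap_below_ideal Lgap Zideal Z0.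
  by exists Y; split; first exact: YZ.1.
have phi_sub Z : phi Z `<=` Z by exact: (phiP Z).1.
pose C := tower phi.
have Cideal : C `<=` @is_closed_lie_ideal R L.
  move=> Z; elim=> {Z} [Z _ Zideal|G _ Gideal]; first exact: ((phiP Z).2 _).1.
  split; [split| |].
  - by move=> Y /Gideal[[]].
  - move=> a x y Gx Gy Y GY; have [[_ YZD] _ _] := Gideal _ GY.
    by apply: YZD; [exact: Gx|exact: Gy].
  - by move=> x y Gy Y GY; have [_ Yl _] := Gideal _ GY; apply: Yl; exact: Gy.
  - by apply: closed_bigI => Y /Gideal[].
have Cfix Z : C Z -> phi Z = Z -> Z = [set 0].
  move=> CZ fixZ; apply: contrapT => Z0.
  by have [[_]] := ((phiP Z).2 (Cideal _ CZ)).2 Z0; rewrite fixZ; case.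
have Cmeet : fam_meet C = [set 0].
  (* The least member contains its own image under [phi], itself a member, hence is fixed. *)
  have CI : C (fam_meet C) by exact: tower_meet.
  apply: Cfix => //; apply/seteqP; split; first exact: phi_sub.
  by move=> x; apply; exact: tower_next.
have CT : C setT.
  have -> : setT = \bigcap_(Y in set0) Y :> set L by rewrite bigcap_set0.
  exact: tower_meet.
have CjoinE G : G !=set0 -> G `<=` C -> exists2 W, C W & fam_join G = W.
  move=> G0 GC; have [W [CW GW GWphi]] := tower_max phi_sub G0 GC.
  have [sW _ cW] := Cideal _ CW.
  exists W => //; apply: fam_join_max => //.
  (* A bound [W] not known to be attained is fixed by [phi], hence zero, and then equals every
     member of [G]. *)
  case: GWphi => // /(Cfix _ CW) W0; have [Y GY] := G0.
  rewrite (_ : W = Y)//; apply/seteqP; split; last exact: GW.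
  by rewrite W0 => _ ->; have [[]] := Cideal _ (GC _ GY).
have join1 Y : C Y -> fam_join [set Y] = Y.
  by move=> /Cideal[? _ ?]; apply: fam_join_max => // _ ->.
have CjoinT : fam_join C = setT.
  by have [? _ ?] := Cideal _ CT; exact: fam_join_max.
exists C; split=> //.
- by split; [exists setT|exact: tower_total].
- split; apply/seteqP; split=> Y.
  + move=> CY; left; exists [set Y]; last by rewrite /fam_meet bigcap_set1.
    by split; [exists Y|move=> _ ->].
  + by case=> [[G [_ GC] <-]|->]; [exact: tower_meet|rewrite CjoinT].
  + move=> CY; left; exists [set Y]; last exact: join1.
    by split; [exists Y|move=> _ ->].
  + case=> [[G [G0 GC] <-]|->]; last exact: tower_meet.
    by have [W CW ->] := CjoinE _ G0 GC.
- move=> Z CZ; rewrite Cmeet => Z0.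
  have [phiZ phiZn] := ((phiP Z).2 (Cideal _ CZ)).2 Z0.
  by exists (phi Z); split=> //; exact: tower_next.
Qed.

Lemma finite_gap_below_separating L :
  (forall z : L, z <> 0 -> exists N (f : L -> N),
    [/\ bounded_lie_hom f, finite_gap_below N & f z <> 0]) ->
  finite_gap_below L.
Proof.
move=> Lsep Z z Zz /Lsep[N [f [fhom Ngap fz0]]].
(* The image of an ideal need not be closed or an ideal; this is why the criterion admits arbitrary
   sets. *)
have fZz : (f @` Z) (f z) by exists z.
have [Y [W [n [g [Yi Wi [glin gker] ZW nZY]]]]] := Ngap _ _ fZz fz0.
exists (f @^-1` Y), (f @^-1` W), n, (g \o f); split.
- exact: ideal_preimage.
- exact: ideal_preimage.
- split=> [a x y Wx Wy|x Wx] /=; last exact: gker.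
  by have [flin _ _] := fhom; rewrite flin; exact: glin.
- by move=> x Zx; apply: ZW; exists x.
- by move=> ZY; apply: nZY => _ [x Zx <-]; exact: ZY.
Qed.

(** Maps killing [I] descend to the quotient by [I] and separate its points. *)
Lemma absorbing_separating L (I : closedLieIdeal L) :
  (forall x, ~ ideal_set I x -> exists N (f : L -> N),
    [/\ bounded_lie_hom f, strongly_F_semisimple N, forall y, ideal_set I y -> f y = 0
      & f x <> 0]) ->
  strongly_F_absorbing I.
Proof.
move=> Isep; apply: finite_gap_below_semisimple.
apply: finite_gap_below_separating => q q0.
have /Isep[N [f [fhom /semisimple_finite_gap_below Ngap fI fq]]] :
    ~ ideal_set I (quot_repr q).
  by move=> /quot_pi_eq0; rewrite quot_piK.
have [h hhom hf] := quot_lift fhom fI.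
by exists N, h; split=> //; rewrite -(quot_piK q) hf.
Qed.

Lemma absorbing_preimage L M (f : L -> M) (J : closedLieIdeal M)
    (fhom : bounded_lie_hom f) :
  strongly_F_absorbing J ->
  strongly_F_absorbing (ClosedLieIdeal (ideal_preimage fhom (ideal_setP J))).
Proof.
move=> Jabs; apply: absorbing_separating => x nJx.
exists (quotAlg J), (@quot_pi R M J \o f); split=> //.
- exact: bounded_lie_hom_comp (quot_pi_hom J).
- by move=> y Jy; exact/quot_pi_eq0.
- by move=> /quot_pi_eq0.
Qed.

Lemma F_s_functorial L M (f : L -> M) :
  bounded_lie_hom f -> f @` F_s L `<=` F_s M.
Proof.
move=> fhom _ [x Fx <-] J Jabs.
exact: (Fx _ (absorbing_preimage fhom Jabs)).
Qed.

Lemma F_s_absorbing L : strongly_F_absorbing (F_s L).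
Proof.
apply: absorbing_separating => x /existsNP[I /not_implyP[Iabs nIx]].
exists (quotAlg I), (@quot_pi R L I); split=> //.
- exact: quot_pi_hom.
- by move=> y Fy; apply/quot_pi_eq0; exact: Fy.
- by move=> /quot_pi_eq0.
Qed.

Lemma F_s_semisimple L : strongly_F_semisimple L -> F_s L = [set 0] :> set L.
Proof.
move=> Lss; apply/seteqP; split; last by move=> _ ->; have [[]] := ideal_setP (F_s L).
have idhom : bounded_lie_hom (@id L).
  by split=> //; exists 1 => x; rewrite mul1r.
have zero_ideal : is_closed_lie_ideal [set 0 : L].
  split; first by split=> // a x y -> ->; rewrite scaler0 addr0.
    by move=> x y ->; have := lieBr 0 0 x; rewrite !subrr.
  exact/accessible_closed_set1/hausdorff_accessible/norm_hausdorff.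
move=> x; apply: (_ : F_s L `<=` ClosedLieIdeal zero_ideal) => {}x; apply.
(* The identity separates points, so the zero ideal is absorbing without identifying its quotient
   with [L]. *)
apply: absorbing_separating => y y0.
by exists L, id; split.
Qed.

End semisimplicity.

Theorem theorem8p23 (R : realType) : over_radical (@F_s R).
Proof.
split=> [L M f [flin flie fbnd _]|L|L I].
- exact: F_s_functorial.
- by apply: F_s_semisimple; exact: F_s_absorbing.
- apply: F_s_functorial; split=> //.
  by exists 1 => x; rewrite mul1r.
Qed.
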